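(* A formula $A$ is provable in Int2GC+FS if and only if $A$ is Kripke-valid, i.e. valid in every Int2GC+FS-frame.
   Context: Formulas are built from a countably infinite set $\mathrm{Var}$ of propositional variables with the connectives $\neg,\vee,\wedge,\to$ and four unary connectives $\blacktriangle,\blacktriangledown,\vartriangle,\triangledown$. The logic Int2GC is the smallest set of formulas (called provable formulas) that contains intuitionistic propositional logic (in this language) and is closed under substitution, modus ponens, and the four rules: from $A\to\triangledown B$ infer $\blacktriangle A\to B$; from $\blacktriangle A\to B$ infer $A\to\triangledown B$; from $A\to\blacktriangledown B$ infer $\vartriangle A\to B$; from $\vartriangle A\to B$ infer $A\to\blacktriangledown B$. The logic Int2GC+FS is the smallest set of formulas closed under the same rules that contains Int2GC and all instances of (FS1) $\blacktriangle(A\to B)\to(\blacktriangledown A\to\blacktriangle B)$, (FS2) $\vartriangle(A\to B)\to(\triangledown A\to\vartriangle B)$, (FS3) $(\blacktriangle A\to\blacktriangledown B)\to\blacktriangledown(A\to B)$, (FS4) $(\vartriangle A\to\triangledown B)\to\triangledown(A\to B)$. For binary relations, $x\,(R\circ S)\,y$ means that there is $z$ with $x\,R\,z$ and $z\,S\,y$; $\ge$ is the inverse of $\le$. An Int2GC+FS-frame is a triple $(X,\le,R)$ where $X$ is a non-empty set, $\le$ is a preorder on $X$, and $R$ is a binary relation on $X$ with $(R\circ{\le})\subseteq({\le}\circ R)$ and $({\ge}\circ R)\subseteq(R\circ{\ge})$. A valuation on the frame is a map $v\colon\mathrm{Var}\to\wp(X)$ such that $x\in v(p)$ and $x\le y$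 imply $y\in v(p)$; a frame with a valuation is a model. Satisfaction in a model is defined by: $x\models p$ iff $x\in v(p)$; $x\models A\wedge B$ iff $x\models A$ and $x\models B$; $x\models A\vee B$ iff $x\models A$ or $x\models B$; $x\models A\to B$ iff for all $y\ge x$, $y\models A$ implies $y\models B$; $x\models\neg A$ iff for no $y\ge x$ does $y\models A$; $x\models\blacktriangle A$ iff there is $y$ with $x\,(R\circ{\ge})\,y$ and $y\models A$; $x\models\triangledown A$ iff for all $y$, $y\,(R\circ{\ge})\,x$ implies $y\models A$; $x\models\vartriangle A$ iff there is $y$ with $y\,({\le}\circ R)\,x$ and $y\models A$; $x\models\blacktriangledown A$ iff for all $y$, $x\,({\le}\circ R)\,y$ implies $y\models A$. A formula is valid in a frame if it is satisfied at every point of every model based on the frame. *)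

(* Defs.v *)
From Stdlib Require Import Relations.

Set Implicit Arguments.

Definition var := nat.

Inductive formula : Type :=
| Atom (p : var)
| Neg (A : formula)
| Or (A B : formula)
| And (A B : formula)
| Imp (A B : formula)
| BUp (A : formula)
| BDown (A : formula)
| WUp (A : formula)
| WDown (A : formula).

Declare Scope form_scope.
Delimit Scope form_scope with form.
Bind Scope form_scope with formula.

Notation "¬ A" := (Neg A) (at level 35, right associativity) : form_scope.
Notation "▲ A" := (BUp A) (at level 35, right associativity) : form_scope.
Notation "▼ A" := (BDown A) (at level 35, right associativity) : form_scope.
Notation "△ A" := (WUp A) (at level 35, right associativity) : form_scope.
Notation "▽ A" := (WDown A) (at level 35, right associativity) : form_scope.
Notation "A ∧ B" := (And A B) (at level 80, right associativity) : form_scope.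
Notation "A ∨ B" := (Or A B) (at level 85, right associativity) : form_scope.
Notation "A → B" := (Imp A B) (at level 90, right associativity) : form_scope.

Fixpoint subst (s : var -> formula) (A : formula) : formula :=
  match A with
  | Atom p => s p
  | Neg A => Neg (subst s A)
  | Or A B => Or (subst s A) (subst s B)
  | And A B => And (subst s A) (subst s B)
  | Imp A B => Imp (subst s A) (subst s B)
  | BUp A => BUp (subst s A)
  | BDown A => BDown (subst s A)
  | WUp A => WUp (subst s A)
  | WDown A => WDown (subst s A)
  end.

(* Intuitionistic propositional logic over the full language: a Hilbert system
   with primitive negation, whose schemes range over all formulas, so that a
   formula headed by one of the four unary connectives behaves as an atom. *)
Inductive IPL : formula -> Prop :=
| IPL_K A B : IPL (A → B → A)
| IPL_S A B C : IPL ((A → B → C) → (A → B) → A → C)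
| IPL_andl A B : IPL (A ∧ B → A)
| IPL_andr A B : IPL (A ∧ B → B)
| IPL_and A B : IPL (A → B → A ∧ B)
| IPL_orl A B : IPL (A → A ∨ B)
| IPL_orr A B : IPL (B → A ∨ B)
| IPL_or A B C : IPL ((A → C) → (B → C) → A ∨ B → C)
| IPL_neg A B : IPL ((A → B) → (A → ¬ B) → ¬ A)
| IPL_efq A B : IPL (¬ A → A → B)
| IPL_mp A B : IPL (A → B) -> IPL A -> IPL B.

(* The smallest set of formulas that contains [Ax] and is closed under
   substitution, modus ponens and the four Galois connection rules. *)
Inductive closure (Ax : formula -> Prop) : formula -> Prop :=
| cl_ax A : Ax A -> closure Ax A
| cl_subst s A : closure Ax A -> closure Ax (subst s A)
| cl_mp A B : closure Ax (A → B) -> closure Ax A -> closure Ax B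
| cl_BUp_elim A B : closure Ax (A → ▽ B) -> closure Ax (▲ A → B)
| cl_WDown_intro A B : closure Ax (▲ A → B) -> closure Ax (A → ▽ B)
| cl_WUp_elim A B : closure Ax (A → ▼ B) -> closure Ax (△ A → B)
| cl_BDown_intro A B : closure Ax (△ A → B) -> closure Ax (A → ▼ B).

Definition Int2GC : formula -> Prop := closure IPL.

Inductive FS : formula -> Prop :=
| FS1 A B : FS (▲ (A → B) → (▼ A → ▲ B))
| FS2 A B : FS (△ (A → B) → (▽ A → △ B))
| FS3 A B : FS ((▲ A → ▼ B) → ▼ (A → B))
| FS4 A B : FS ((△ A → ▽ B) → ▽ (A → B)).

Definition Int2GC_FS : formula -> Prop :=
  closure (fun A => Int2GC A \/ FS A).

Definition comp {X : Type} (R S : relation X) : relation X :=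
  fun x y => exists z, R x z /\ S z y.

Notation "R ⊚ S" := (comp R S) (at level 40, left associativity).
Notation "R ^⁻¹" := (transp _ R) (at level 1, left associativity, format "R ^⁻¹").

Record frame : Type := Frame {
  point :> Type;
  le : relation point;
  acc : relation point;
  point_inhabited : inhabited point;
  le_preorder : preorder point le;
  acc_le : inclusion point (acc ⊚ le) (le ⊚ acc);
  ge_acc : inclusion point (le^⁻¹ ⊚ acc) (acc ⊚ le^⁻¹)
}.

Record valuation (F : frame) : Type := Valuation {
  val :> var -> F -> Prop;
  val_up : forall p x y, val p x -> le F x y -> val p y
}.

Fixpoint sat (F : frame) (v : valuation F) (x : F) (A : formula) : Prop :=
  match A with
  | Atom p => v p x
  | Neg A => ~ exists y, le F x y /\ sat v y A
  | Or A B => sat v x A \/ sat v x B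
  | And A B => sat v x A /\ sat v x B
  | Imp A B => forall y, le F x y -> sat v y A -> sat v y B
  | BUp A => exists y, (acc F ⊚ (le F)^⁻¹) x y /\ sat v y A
  | WDown A => forall y, (acc F ⊚ (le F)^⁻¹) y x -> sat v y A
  | WUp A => exists y, (le F ⊚ acc F) y x /\ sat v y A
  | BDown A => forall y, (le F ⊚ acc F) x y -> sat v y A
  end.

Definition valid (F : frame) (A : formula) : Prop :=
  forall (v : valuation F) (x : F), sat v x A.

Definition kripke_valid (A : formula) : Prop :=
  forall F : frame, valid F A.

(* Main.v *)
(** Completeness goes through the canonical model of prime theories ordered by
    inclusion, where [F] is related to [G] when [▼A ∈ F] implies [A ∈ G] and
    [A ∈ G] implies [▲A ∈ F].  The Galois connections make this equivalent to
    the mirror condition on [△] and [▽] with [F] and [G] exchanged, so every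
    construction is carried out for an abstract quadruple of connectives and used
    twice.  The prime theories witnessing the frame conditions exist thanks to
    (FS1) and (FS3). *)

From Stdlib Require Import Relations Arith Lia Cantor Classical.
Require Import Defs.

Set Implicit Arguments.
Unset Strict Implicit.
Open Scope form_scope.

(** * Soundness: persistence, substitution, validity of axioms and rules *)

Lemma sat_up (F : frame) (v : valuation F) A (x y : F) :
  le F x y -> sat v x A -> sat v y A.
Proof.
destruct (le_preorder F) as [le_refl le_trans].
revert x y; induction A as
  [p|A IH|A IHA B IHB|A IHA B IHB|A IHA B IHB|A IH|A IH|A IH|A IH];
  simpl; intros x y xy H.
- exact (val_up v p x y H xy).
- intros (z & yz & Hz); apply H; exists z; split; [exact (le_trans _ _ _ xy yz)|exact Hz].
- destruct H as [H|H]; eauto.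
- destruct H as [HA HB]; eauto.
- intros z yz; exact (H z (le_trans _ _ _ xy yz)).
(* [ge_acc] transports the [acc]-step from [x] up to [y], so the old witness [u] still serves;
   [acc_le] does the same in the [△] case. *)
- destruct H as (u & (z & xz & uz) & Hu).
  destruct (@ge_acc F y z) as (w & yw & zw); [exists x; split; assumption|].
  exists u; split; [|exact Hu].
  exists w; split; [exact yw|exact (le_trans _ _ _ uz zw)].
- intros u (z & yz & zu); apply H; exists z; split; [exact (le_trans _ _ _ xy yz)|exact zu].
- destruct H as (u & (z & uz & zx) & Hu).
  destruct (@acc_le F z y) as (w & zw & wy); [exists x; split; assumption|].
  exists u; split; [|exact Hu].
  exists w; split; [exact (le_trans _ _ _ uz zw)|exact wy].
- intros u (z & uz & yz); apply H; exists z; split; [exact uz|exact (le_trans _ _ _ xy yz)].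
Qed.

Definition subst_valuation (F : frame) (v : valuation F) (s : var -> formula) :
    valuation F :=
  @Valuation F (fun p x => sat v x (s p)) (fun p x y H xy => @sat_up F v (s p) x y xy H).

Lemma sat_subst (F : frame) (v : valuation F) s A (x : F) :
  sat v x (subst s A) <-> sat (subst_valuation v s) x A.
Proof.
revert x; induction A as
  [p|A IH|A IHA B IHB|A IHA B IHB|A IHA B IHB|A IH|A IH|A IH|A IH];
  simpl; intros x; firstorder.
Qed.

Lemma IPL_valid (F : frame) A : IPL A -> valid F A.
Proof.
destruct (le_preorder F) as [le_refl le_trans].
intros H v; induction H; simpl; intros x.
- intros y _ HA z yz _; exact (sat_up yz HA).
- intros y _ H1 z yz H2 w zw HA.
  apply (H1 w (le_trans _ _ _ yz zw) HA w (le_refl w)); exact (H2 w zw HA).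
- intros y _ [HA _]; exact HA.
- intros y _ [_ HB]; exact HB.
- intros y _ HA z yz HB; split; [exact (sat_up yz HA)|exact HB].
- intros y _ HA; left; exact HA.
- intros y _ HB; right; exact HB.
- intros y _ HA z yz HB w zw [H|H]; [exact (HA w (le_trans _ _ _ yz zw) H)|exact (HB w zw H)].
- intros y _ H1 z yz H2 (w & zw & HA).
  apply (H2 w zw HA); exists w; split; [apply le_refl|].
  exact (H1 w (le_trans _ _ _ yz zw) HA).
- intros y _ H1 z yz HA; destruct H1; exists z; split; assumption.
- exact (IHIPL1 x x (le_refl x) (IHIPL2 x)).
Qed.

(** Each case rests on a point [w] given by a frame condition: [ge_acc] for (FS1) and (FS4),
    [acc_le] for (FS2) and (FS3). For the first two schemes the implication and its premise meet at
    [w], which becomes the witness. For the last two the assumed implication is applied at [w], and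
    its existential premise is witnessed by the very point where the conclusion is wanted. *)
Lemma FS_valid (F : frame) A : FS A -> valid F A.
Proof.
destruct (le_preorder F) as [le_refl le_trans].
intros [B C|B C|B C|B C] v t; simpl; intros x _.
- intros (u & (z & xz & uz) & Hu) x' xx' HB.
  destruct (@ge_acc F x' z) as (w & x'w & zw); [exists x; split; assumption|].
  exists w; split; [exists w; split; [exact x'w|apply le_refl]|].
  apply Hu; [exact (le_trans _ _ _ uz zw)|].
  apply HB; exists x'; split; [apply le_refl|exact x'w].
- intros (u & (z & uz & zx) & Hu) x' xx' HB.
  destruct (@acc_le F z x') as (w & zw & wx'); [exists x; split; assumption|].
  exists w; split; [exists w; split; [apply le_refl|exact wx']|].
  apply Hu; [exact (le_trans _ _ _ uz zw)|].
  apply HB; exists x'; split; [exact wx'|apply le_refl].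
- intros H y (z & xz & zy) y' yy' HB.
  destruct (@acc_le F z y') as (w & zw & wy'); [exists y; split; assumption|].
  apply (H w (le_trans _ _ _ xz zw)).
  + exists y'; split; [exists y'; split; [exact wy'|apply le_refl]|exact HB].
  + exists w; split; [apply le_refl|exact wy'].
- intros H y (z & yz & xz) y' yy' HB.
  destruct (@ge_acc F y' z) as (w & y'w & zw); [exists y; split; assumption|].
  apply (H w (le_trans _ _ _ xz zw)).
  + exists y'; split; [exists y'; split; [apply le_refl|exact y'w]|exact HB].
  + exists w; split; [exact y'w|apply le_refl].
Qed.

(** The axioms are arbitrary because [Int2GC_FS] is a closure over a closure, and both layers need
    this argument. The Galois rules are sound since [▲] and [▽], and likewise [△] and [▼], quantify
    along one relation in opposite directions. *)
Lemma closure_valid (F : frame) (Ax : formula -> Prop) :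
  (forall A, Ax A -> valid F A) -> forall A, closure Ax A -> valid F A.
Proof.
destruct (le_preorder F) as [le_refl le_trans].
intros HAx A H; induction H as
  [A H|s A _ IH|A B _ IHAB _ IHA|A B _ IH|A B _ IH|A B _ IH|A B _ IH];
  intros v x; simpl.
- exact (HAx A H v x).
- apply sat_subst; apply IH.
- exact (IHAB v x x (le_refl x) (IHA v x)).
- intros y _ (u & (z & yz & uz) & Hu).
  apply (IH v u u (le_refl u) Hu); exists z; split; assumption.
- intros y _ HA z Hzy; apply (IH v z z (le_refl z)); exists y; split; assumption.
- intros y _ (u & (z & uz & zy) & Hu).
  apply (IH v u u (le_refl u) Hu); exists z; split; assumption.
- intros y _ HA z Hyz; apply (IH v z z (le_refl z)); exists y; split; assumption.
Qed.

Lemma soundness A : Int2GC_FS A -> kripke_valid A.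
Proof.
intros H F; revert A H; apply closure_valid; intros A [H|H].
- revert A H; apply closure_valid; apply IPL_valid.
- exact (@FS_valid F A H).
Qed.

(** * Theories and intuitionistic reasoning inside them *)

Record theory (T : formula -> Prop) : Prop := {
  theory_prov : forall A, Int2GC_FS A -> T A;
  theory_mp : forall A B, T (A → B) -> T A -> T B
}.

Lemma prov_IPL A : IPL A -> Int2GC_FS A.
Proof. intros H; apply cl_ax; left; apply cl_ax; exact H. Qed.

Lemma prov_theory : theory Int2GC_FS.
Proof. split; [auto|intros A B; apply cl_mp]. Qed.

Section Theory.
Context (T : formula -> Prop) (HT : theory T).

Lemma theory_IPL A : IPL A -> T A.
Proof. intros H; apply (theory_prov HT), prov_IPL, H. Qed.

Lemma theory_weaken A B : T B -> T (A → B).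
Proof. apply (theory_mp HT), theory_IPL, IPL_K. Qed.

Lemma theory_imp_mp A B C : T (A → B → C) -> T (A → B) -> T (A → C).
Proof.
intros H; apply (theory_mp HT); revert H; apply (theory_mp HT), theory_IPL, IPL_S.
Qed.

(** Takes the place of a deduction theorem: reasoning under the hypothesis [A] is reasoning in
    another theory, so the other lemmas of the section apply to it. *)
Lemma theory_under A : theory (fun C => T (A → C)).
Proof.
split; [|intros B C; apply theory_imp_mp].
intros B HB; apply theory_weaken, (theory_prov HT), HB.
Qed.

Lemma theory_imp_trans A B C : T (A → B) -> T (B → C) -> T (A → C).
Proof. intros HAB HBC; apply (theory_imp_mp (B := B)); [apply theory_weaken|]; assumption. Qed.

Lemma theory_imp_refl A : T (A → A).
Proof. apply (theory_imp_mp (B := A → A)); apply theory_IPL, IPL_K. Qed.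

Lemma theory_and A B : T (A ∧ B) <-> T A /\ T B.
Proof.
split.
- intros H; split; revert H; apply (theory_mp HT), theory_IPL; constructor.
- intros [HA HB]; refine (theory_mp HT _ HB); revert HA.
  apply (theory_mp HT), theory_IPL, IPL_and.
Qed.

Lemma theory_or_elim A B C : T (A → C) -> T (B → C) -> T (A ∨ B → C).
Proof.
intros HA HB; refine (theory_mp HT _ HB); revert HA.
apply (theory_mp HT), theory_IPL, IPL_or.
Qed.

Lemma theory_neg A B : T (A → B) -> T (A → ¬ B) -> T (¬ A).
Proof.
intros H1 H2; refine (theory_mp HT _ H2); revert H1.
apply (theory_mp HT), theory_IPL, IPL_neg.
Qed.

Lemma theory_efq A B : T (¬ A) -> T A -> T B.
Proof.
intros H; apply (theory_mp HT); revert H; apply (theory_mp HT), theory_IPL, IPL_efq.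
Qed.

End Theory.

(** * Prime theories and the Lindenbaum construction *)

Record prime (P : formula -> Prop) : Prop := {
  prime_theory :> theory P;
  prime_proper : exists A, ~ P A;
  prime_or : forall A B, P (A ∨ B) -> P A \/ P B
}.

Definition Top : formula := Atom 0 → Atom 0.
Definition Bot : formula := ¬ Top.

Lemma prov_Top : Int2GC_FS Top.
Proof. exact (theory_imp_refl prov_theory _). Qed.

Lemma prov_Bot A : Int2GC_FS (Bot → A).
Proof.
pose proof (theory_under prov_theory Bot) as H.
apply (theory_efq H (A := Top)); [apply (theory_imp_refl prov_theory)|].
apply (theory_prov H), prov_Top.
Qed.

(** Injectivity suffices for the construction below: a number that codes no formula adds nothing at
    its stage. *)
Fixpoint code (A : formula) : nat :=
  match A with
  | Atom p => to_nat (0, p)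
  | Neg A => to_nat (1, code A)
  | Or A B => to_nat (2, to_nat (code A, code B))
  | And A B => to_nat (3, to_nat (code A, code B))
  | Imp A B => to_nat (4, to_nat (code A, code B))
  | BUp A => to_nat (5, code A)
  | BDown A => to_nat (6, code A)
  | WUp A => to_nat (7, code A)
  | WDown A => to_nat (8, code A)
  end.

Lemma to_nat_eq m n m' n' : to_nat (m, n) = to_nat (m', n') -> m = m' /\ n = n'.
Proof. intros H%to_nat_inj; split; congruence. Qed.

Lemma code_inj A B : code A = code B -> A = B.
Proof.
revert B; induction A; intros []; cbn [code]; intros [H1 H2]%to_nat_eq;
  try discriminate H1; try (apply to_nat_eq in H2; destruct H2); f_equal; auto.
Qed.

(* [fun C => T (B → C)] is the theory obtained from [T] by adjoining [B]. *)
Fixpoint stage (H D : formula -> Prop) (n : nat) : formula -> Prop :=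
  match n with
  | 0 => H
  | S n => fun C => stage H D n C \/
      exists B, code B = n /\ (forall E, D E -> ~ stage H D n (B → E)) /\
        stage H D n (B → C)
  end.

Lemma stage_mono H D m n C : m <= n -> stage H D m C -> stage H D n C.
Proof. induction 1; simpl; auto. Qed.

Lemma stage_theory H D n : theory H -> theory (stage H D n).
Proof.
intros HH; induction n as [|n IH]; [exact HH|split; simpl].
- intros A HA; left; exact (theory_prov IH HA).
- intros A C [HAC|(B & Bn & HB & HAC)] [HA|(B' & Bn' & HB' & HA)].
  + left; exact (theory_mp IH HAC HA).
  + right; exists B'; repeat split; trivial.
    exact (theory_imp_trans IH HA HAC).
  + right; exists B; repeat split; trivial.
    exact (theory_imp_mp IH HAC (theory_weaken IH B HA)).
  (* Both formulas entered through the formula coded by [n], which is unique, so they share one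
     hypothesis. *)
  + rewrite <- Bn' in Bn; apply code_inj in Bn; subst B'.
    right; exists B; repeat split; trivial.
    exact (theory_imp_mp IH HAC HA).
Qed.

Lemma stage_avoids H D n :
  (forall E, D E -> ~ H E) -> forall E, D E -> ~ stage H D n E.
Proof.
intros HD; induction n as [|n IH]; [exact HD|].
intros E HE [HE'|(B & _ & HB & HE')]; [exact (IH E HE HE')|exact (HB E HE HE')].
Qed.

(** The order is provable implication. Directedness lets a set to be avoided act as an ideal without
    first being closed under disjunction. *)
Definition up_directed (D : formula -> Prop) : Prop :=
  (exists A, D A) /\
  forall A B, D A -> D B -> exists C, D C /\ Int2GC_FS (A → C) /\ Int2GC_FS (B → C).

Definition down_directed (S : formula -> Prop) : Prop :=
  (exists A, S A) /\
  forall A B, S A -> S B -> exists C, S C /\ Int2GC_FS (C → A) /\ Int2GC_FS (C → B).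

Lemma up_directed_singleton A : up_directed (eq A).
Proof.
split; [exists A; reflexivity|intros B C <- <-].
exists A; repeat split; apply (theory_imp_refl prov_theory).
Qed.

(** The union of the stages is a theory avoiding [D], and any formula outside it implies in it some
    member of [D]. If both disjuncts were outside, directedness would give a common member of [D]
    implied by both, hence by the disjunction. *)
Lemma prime_extension H D :
  theory H -> up_directed D -> (forall E, D E -> ~ H E) ->
  exists P, prime P /\ (forall A, H A -> P A) /\ (forall A, D A -> ~ P A).
Proof.
intros HH [[E0 HE0] Ddir] HD; exists (fun C => exists n, stage H D n C).
assert (avoids : forall A, D A -> ~ exists n, stage H D n A).
{ intros A HA [n Hn]; exact (stage_avoids HD HA Hn). }
assert (limit : theory (fun C => exists n, stage H D n C)).
{ split.
  - intros A HA; exists 0; exact (theory_prov HH HA).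
  - intros A B [m Hm] [n Hn]; exists (max m n).
    apply (theory_mp (stage_theory D (max m n) HH) (A := A)).
    + apply (stage_mono (m := m)); [lia|exact Hm].
    + apply (stage_mono (m := n)); [lia|exact Hn]. }
assert (refuted : forall A, ~ (exists n, stage H D n A) ->
          exists E, D E /\ exists n, stage H D n (A → E)).
(* If [A] implied no member of [D] at stage [code A], the next stage would have adjoined [A]. *)
{ intros A HA; apply NNPP; intros no; apply HA; exists (S (code A)); right.
  exists A; repeat split.
  - intros E HE HAE; apply no; exists E; split; [exact HE|exists (code A); exact HAE].
  - apply theory_imp_refl, stage_theory, HH. }
repeat split; trivial; try apply limit.
- exists E0; apply avoids, HE0.
- intros A B HAB; apply NNPP; intros [HA HB]%not_or_and.
  destruct (refuted A HA) as (E1 & D1 & H1), (refuted B HB) as (E2 & D2 & H2).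
  destruct (Ddir E1 E2 D1 D2) as (E & HE & E1E & E2E).
  apply (avoids E HE).
  refine (theory_mp limit _ HAB); apply (theory_or_elim limit).
  + exact (theory_imp_trans limit H1 (theory_prov limit E1E)).
  + exact (theory_imp_trans limit H2 (theory_prov limit E2E)).
- intros A HA; exists 0; exact HA.
Qed.

(** Reduces to [prime_extension] for the theory generated by [H] and [S]; since [S] is directed
    downwards, one premise from [S] suffices for each consequence. *)
Lemma prime_separation H S D :
  theory H -> down_directed S -> up_directed D ->
  (forall A E, S A -> D E -> ~ H (A → E)) ->
  exists P, prime P /\ (forall A, H A -> P A) /\ (forall A, S A -> P A) /\
    (forall A, D A -> ~ P A).
Proof.
intros HH [[A0 HA0] Sdir] HD sep.
destruct (@prime_extension (fun C => exists A, S A /\ H (A → C)) D)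
  as (P & PP & HP & DP); trivial.
- split.
  + intros A HA; exists A0; split; [exact HA0|].
    apply (theory_weaken HH), (theory_prov HH), HA.
  + intros B C (A1 & S1 & H1) (A2 & S2 & H2).
    destruct (Sdir A1 A2 S1 S2) as (A & HA & AA1 & AA2).
    exists A; split; [exact HA|].
    apply (theory_imp_mp HH (B := B)).
    * exact (theory_imp_trans HH (theory_prov HH AA1) H1).
    * exact (theory_imp_trans HH (theory_prov HH AA2) H2).
- intros E HE (A & HA & HAE); exact (sep A E HA HE HAE).
- exists P; repeat split; try apply PP; trivial.
  + intros A HA; apply HP; exists A0; split; [exact HA0|apply (theory_weaken HH), HA].
  + intros A HA; apply HP; exists A; split; [exact HA|apply (theory_imp_refl HH)].
Qed.

(** * Galois connections and the existence of related prime theories *)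

Record gc_quadruple (up dn up' dn' : formula -> formula) : Prop := {
  gc_up : forall A B, Int2GC_FS (up A → B) <-> Int2GC_FS (A → dn' B);
  gc_dn : forall A B, Int2GC_FS (up' A → B) <-> Int2GC_FS (A → dn B);
  fs_up : forall A B, Int2GC_FS (up (A → B) → dn A → up B);
  fs_dn : forall A B, Int2GC_FS ((up A → dn B) → dn (A → B))
}.

(** Adjoints have opposite colours: [▽] is right adjoint to [▲], and [▼] to [△]. This instance draws
    on (FS1) and (FS3), its mirror image on (FS2) and (FS4). *)
Lemma black_gc : gc_quadruple BUp BDown WUp WDown.
Proof.
split; intros A B.
- split; [apply cl_WDown_intro|apply cl_BUp_elim].
- split; [apply cl_BDown_intro|apply cl_WUp_elim].
- apply cl_ax; right; constructor.
- apply cl_ax; right; constructor.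
Qed.

Lemma white_gc : gc_quadruple WUp WDown BUp BDown.
Proof.
split; intros A B.
- split; [apply cl_BDown_intro|apply cl_WUp_elim].
- split; [apply cl_WDown_intro|apply cl_BUp_elim].
- apply cl_ax; right; constructor.
- apply cl_ax; right; constructor.
Qed.

Definition crel (up dn : formula -> formula) (F G : formula -> Prop) : Prop :=
  (forall A, F (dn A) -> G A) /\ (forall A, G A -> F (up A)).

Section Canonical.
Context (up dn up' dn' : formula -> formula) (Q : gc_quadruple up dn up' dn').

Let prov_refl := theory_imp_refl prov_theory.
Let prov_trans := theory_imp_trans prov_theory.

Lemma up_mono A B : Int2GC_FS (A → B) -> Int2GC_FS (up A → up B).
Proof.
intros H; apply (gc_up Q); apply (prov_trans H).
apply (gc_up Q), prov_refl.
Qed.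

Lemma dn_mono A B : Int2GC_FS (A → B) -> Int2GC_FS (dn A → dn B).
Proof.
intros H; apply (gc_dn Q); refine (prov_trans _ H).
apply (gc_dn Q), prov_refl.
Qed.

(** A left adjoint preserves joins: transposition reduces the claim to the two injections into the
    disjunction. *)
Lemma up_or A B : Int2GC_FS (up (A ∨ B) → up A ∨ up B).
Proof.
apply (gc_up Q), (theory_or_elim prov_theory); apply (gc_up Q);
  apply prov_IPL; constructor.
Qed.

Lemma up_Bot A : Int2GC_FS (up Bot → A).
Proof. apply (gc_up Q), prov_Bot. Qed.

Lemma dn_and A B : Int2GC_FS (dn A ∧ dn B → dn (A ∧ B)).
Proof.
apply (gc_dn Q).
apply (theory_and (theory_under prov_theory _)); split;
  apply (gc_dn Q); apply prov_IPL; constructor.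
Qed.

(** Transpose [up' Top → A] and detach [Top]. *)
Lemma dn_nec A : Int2GC_FS A -> Int2GC_FS (dn A).
Proof.
intros HA; refine (cl_mp _ prov_Top).
apply (gc_dn Q), (theory_weaken prov_theory), HA.
Qed.

Lemma dn_theory F : theory F -> theory (fun A => F (dn A)).
Proof.
intros HF; split.
- intros A HA; apply (theory_prov HF), dn_nec, HA.
- intros A B HAB HA; apply (theory_mp HF (A := dn ((A → B) ∧ A))).
  + apply (theory_prov HF), dn_mono.
    pose proof (theory_under prov_theory ((A → B) ∧ A)) as HT.
    apply (theory_mp HT (A := A)); apply prov_IPL; constructor.
  + apply (theory_mp HF (A := dn (A → B) ∧ dn A)).
    * apply (theory_prov HF), dn_and.
    * apply (theory_and HF); split; assumption.
Qed.

(** The first half uses the counit [up (dn' A) → A], the second the unit [A → dn (up' A)]. *)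
Lemma crel_mirror F G : theory F -> theory G -> crel up dn F G -> crel up' dn' G F.
Proof.
intros HF HG [H1 H2]; split; intros A HA.
- refine (theory_mp HF _ (H2 _ HA)).
  apply (theory_prov HF), (gc_up Q), prov_refl.
- apply H1; refine (theory_mp HF _ HA).
  apply (theory_prov HF), (gc_dn Q), prov_refl.
Qed.

(** [G] must contain every [B] with [dn B] in [F] and avoid every [C] with [up C] outside [F]; the
    latter form an ideal because [F] is prime. If [H] contained [A → E] across this divide,
    [up (A → E)] and [dn A] would be in [F], and [fs_up] would put [up E] there. *)
Lemma crel_successor F H :
  prime F -> theory H -> (forall A, H A -> F (up A)) ->
  exists G, prime G /\ (forall A, H A -> G A) /\ crel up dn F G.
Proof.
intros PF HH HF.
destruct (@prime_separation H (fun B => F (dn B)) (fun C => ~ F (up C)))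
  as (G & PG & HG & SG & DG); trivial.
- split.
  + exists Top; apply (theory_prov PF), dn_nec, prov_Top.
  + intros A B HA HB; exists (A ∧ B); split; [|split; apply prov_IPL; constructor].
    apply (theory_mp PF (A := dn A ∧ dn B)); [apply (theory_prov PF), dn_and|].
    apply (theory_and PF); split; assumption.
- split.
  + destruct (prime_proper PF) as [A HA]; exists Bot; intros HB; apply HA.
    refine (theory_mp PF _ HB); apply (theory_prov PF), up_Bot.
  + intros A B HA HB; exists (A ∨ B); split; [|split; apply prov_IPL; constructor].
    intros HAB; destruct (prime_or PF (theory_mp PF (theory_prov PF (up_or A B)) HAB)); auto.
- intros A E HA HE HAE; apply HE; refine (theory_mp PF _ HA).
  refine (theory_mp PF _ (HF _ HAE)); apply (theory_prov PF), (fs_up Q).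
- exists G; repeat split; try apply PG; trivial.
  intros A HA; apply NNPP; intros no; exact (DG A no HA).
Qed.

(** [F] is enlarged by all [up A] with [A] in [G], avoiding all [dn B] with [B] outside [G]. If
    [up A → dn B] were in [F], [fs_dn] would give [dn (A → B)], so [A → B] and then [B] would be in
    [G]. *)
Lemma crel_extension F G :
  theory F -> prime G -> (forall A, F (dn A) -> G A) ->
  exists F', prime F' /\ (forall A, F A -> F' A) /\ crel up dn F' G.
Proof.
intros HF PG HG.
destruct (@prime_separation F (fun B => exists A, G A /\ B = up A)
    (fun C => exists A, ~ G A /\ C = dn A)) as (F' & PF' & HF' & SF' & DF'); trivial.
- split.
  + exists (up Top), Top; split; [apply (theory_prov PG), prov_Top|reflexivity].
  + intros _ _ (A & HA & ->) (B & HB & ->); exists (up (A ∧ B)); split.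
    * exists (A ∧ B); split; [|reflexivity].
      apply (theory_and PG); split; assumption.
    * split; apply up_mono, prov_IPL; constructor.
- split.
  + destruct (prime_proper PG) as [A HA]; exists (dn A), A; split; trivial.
  + intros _ _ (A & HA & ->) (B & HB & ->); exists (dn (A ∨ B)); split.
    * exists (A ∨ B); split; [|reflexivity].
      intros H; destruct (prime_or PG H); auto.
    * split; apply dn_mono, prov_IPL; constructor.
- intros _ _ (A & HA & ->) (B & HB & ->) H; apply HB.
  refine (theory_mp PG _ HA); apply HG.
  refine (theory_mp HF _ H); apply (theory_prov HF), (fs_dn Q).
- exists F'; repeat split; try apply PF'; trivial.
  + intros A HA; apply NNPP; intros no; apply (DF' (dn A)); [|exact HA].
    exists A; split; trivial.
  + intros A HA; apply SF'; exists A; split; trivial.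
Qed.

Lemma crel_up_witness F A :
  prime F -> F (up A) -> exists G, prime G /\ crel up dn F G /\ G A.
Proof.
intros PF HA.
(* The starting theory consists of the consequences of [A]; monotonicity of [up] places their images
   in [F]. *)
destruct (@crel_successor F (fun C => Int2GC_FS (A → C))) as (G & PG & HG & FG); trivial.
- apply (theory_under prov_theory).
- intros C HC; refine (theory_mp PF _ HA); apply (theory_prov PF), up_mono, HC.
- exists G; split; [exact PG|split; [exact FG|apply HG, prov_refl]].
Qed.

(** The theory [G] is built to respect only the [dn] half of [crel], and [up] may fail at [F]
    itself. Passing to a larger [F'] repairs this, matching the [le]-step in the semantics of [▼]
    and [▽]. *)
Lemma crel_dn_witness F A :
  prime F -> ~ F (dn A) ->
  exists F' G, prime F' /\ prime G /\ (forall B, F B -> F' B) /\ crel up dn F' G /\ ~ G A.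
Proof.
intros PF HA.
destruct (@prime_extension (fun C => F (dn C)) (eq A)) as (G & PG & HG & DG).
- apply dn_theory, PF.
- apply up_directed_singleton.
- intros E <-; exact HA.
- destruct (@crel_extension F G PF PG HG) as (F' & PF' & FF' & F'G).
  exists F', G; auto 6.
Qed.

End Canonical.

(** * The canonical model, the truth lemma and completeness *)

Definition world : Type := {P : formula -> Prop | prime P}.

Definition canonical_le : relation world :=
  fun x y => forall A, proj1_sig x A -> proj1_sig y A.

Definition canonical_acc : relation world :=
  fun x y => crel BUp BDown (proj1_sig x) (proj1_sig y).

Lemma canonical_le_preorder : preorder world canonical_le.
Proof. split; unfold canonical_le; red; auto. Qed.

Lemma canonical_acc_le :
  inclusion world (canonical_acc ⊚ canonical_le) (canonical_le ⊚ canonical_acc).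
Proof.
intros [F PF] [G' PG'] ([G PG] & [FG _] & GG').
destruct (crel_extension black_gc PF PG') as (F' & PF' & FF' & F'G').
- intros A HA; apply GG', FG, HA.
- exists (exist _ F' PF'); split; assumption.
Qed.

Lemma canonical_ge_acc :
  inclusion world (canonical_le^⁻¹ ⊚ canonical_acc) (canonical_acc ⊚ canonical_le^⁻¹).
Proof.
intros [F' PF'] [G PG] ([F PF] & FF' & [_ FG]).
destruct (crel_successor black_gc PF' PG) as (G' & PG' & GG' & F'G').
- intros A HA; apply FF', FG, HA.
- exists (exist _ G' PG'); split; assumption.
Qed.

(** Non-emptiness is a parameter: in [completeness] the prime theory omitting the unprovable formula
    supplies it. *)
Definition canonical_frame (w : inhabited world) : frame :=
  Frame w canonical_le_preorder canonical_acc_le canonical_ge_acc.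

Definition canonical_valuation (w : inhabited world) : valuation (canonical_frame w) :=
  @Valuation (canonical_frame w) (fun p x => proj1_sig x (Atom p))
    (fun p x y H xy => xy (Atom p) H).

(** Lets the [△] and [▽] cases of [truth] reuse the witness lemmas through [white_gc]. *)
Lemma canonical_acc_white (x y : world) :
  canonical_acc x y <-> crel WUp WDown (proj1_sig y) (proj1_sig x).
Proof.
destruct x as [F PF], y as [G PG].
split; [apply (crel_mirror black_gc PF PG)|apply (crel_mirror white_gc PG PF)].
Qed.

Lemma truth w A (x : world) :
  @sat (canonical_frame w) (canonical_valuation w) x A <-> proj1_sig x A.
Proof.
revert x; induction A as
  [p|A IH|A IHA B IHB|A IHA B IHB|A IHA B IHB|A IH|A IH|A IH|A IH];
  intros [F PF]; simpl.
- reflexivity.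
- split.
  + intros H; apply NNPP; intros HA; apply H.
    destruct (@prime_extension (fun C => F (A → C)) (eq Bot)) as (P & PP & HP & DP).
    * apply (theory_under PF).
    * apply up_directed_singleton.
    (* [Bot] is [¬ Top], so if [A] implied it in [F], [A] would imply both [Top] and its
       negation. *)
    * intros E <- HB; apply HA, (theory_neg PF (B := Top)); [|exact HB].
      apply (theory_weaken PF), (theory_prov PF), prov_Top.
    * exists (exist _ P PP); split.
      -- intros B HB; apply HP, (theory_weaken PF), HB.
      -- apply IH; apply HP, (theory_imp_refl PF).
  + intros HA ([G PG] & FG & HG); apply IH in HG; apply FG in HA.
    destruct (prime_proper PG) as [B HB]; apply HB.
    exact (theory_efq PG _ HA HG).
- rewrite IHA, IHB; simpl; split.
  + intros [H|H]; revert H; apply (theory_mp PF), (theory_IPL PF); constructor.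
  + apply (prime_or PF).
- rewrite IHA, IHB; symmetry; apply (theory_and PF).
- split.
  + intros H; apply NNPP; intros HAB.
    destruct (@prime_extension (fun C => F (A → C)) (eq B)) as (P & PP & HP & DP).
    * apply (theory_under PF).
    * apply up_directed_singleton.
    * intros E <-; exact HAB.
    * apply (DP B eq_refl); apply (IHB (exist _ P PP)), H.
      -- intros C HC; apply HP, (theory_weaken PF), HC.
      -- apply IHA; apply HP, (theory_imp_refl PF).
  + intros HAB [G PG] FG HA; apply IHB; apply IHA in HA; apply FG in HAB.
    exact (theory_mp PG HAB HA).
- split.
  + intros (y & (z & xz & yz) & Hy); apply IH in Hy; apply xz, yz, Hy.
  + intros HA; destruct (crel_up_witness black_gc PF HA) as (G & PG & FG & GA).
    exists (exist _ G PG); split; [|apply IH, GA].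
    (* The same world is also the intermediate point, the [le]-step being reflexive. *)
    exists (exist _ G PG); split; [exact FG|exact (fun B H => H)].
- split.
  + intros H; apply NNPP; intros HA.
    destruct (crel_dn_witness black_gc PF HA) as (F' & G & PF' & PG & FF' & F'G & GA).
    apply GA, (IH (exist _ G PG)), H.
    exists (exist _ F' PF'); split; assumption.
  + intros HA y (z & xz & zy); apply IH; apply zy, xz, HA.
- split.
  + intros (y & (z & yz & zx) & Hy); apply IH in Hy.
    apply canonical_acc_white in zx; apply zx, yz, Hy.
  + intros HA; destruct (crel_up_witness white_gc PF HA) as (G & PG & FG & GA).
    exists (exist _ G PG); split; [|apply IH, GA].
    exists (exist _ G PG); split; [exact (fun B H => H)|apply canonical_acc_white, FG].
- split.
  + intros H; apply NNPP; intros HA.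
    destruct (crel_dn_witness white_gc PF HA) as (F' & G & PF' & PG & FF' & F'G & GA).
    apply GA, (IH (exist _ G PG)), H.
    exists (exist _ F' PF'); split; [apply canonical_acc_white, F'G|exact FF'].
  + intros HA y (z & yz & xz); apply IH; apply canonical_acc_white in yz; apply yz, xz, HA.
Qed.

Lemma completeness A : kripke_valid A -> Int2GC_FS A.
Proof.
intros H; apply NNPP; intros HA.
destruct (@prime_extension Int2GC_FS (eq A)) as (P & PP & _ & DP).
- apply prov_theory.
- apply up_directed_singleton.
- intros E <-; exact HA.
- pose (x := exist _ P PP : world); apply (DP A eq_refl).
  apply (truth (inhabits x) A x), H.
Qed.

Theorem theorem4p16 (A : formula) : Int2GC_FS A <-> kripke_valid A.
Proof. split; [apply soundness|apply completeness]. Qed.
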